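(* Let $b\ge0$. Then the Geometric Trimmed Sum $\mathrm{GTS}$ (with parameter $b$) is a $(b,\rho)$-robust summation with $\rho=4$, and the practical clipped sum $\mathrm{CS}_+$ (with parameter $b$) is a $(b,\rho)$-robust summation with $\rho=2$.
   Context: Robust summation: an aggregation rule $F$ maps $(\omega_i,z_i)_{i\in[n]}\in(\mathbb R_+\times\mathbb R^d)^n$ to $\mathbb R^d$. For $b,\rho\ge 0$ it is a $(b,\rho)$-robust summation if for all vectors $z_i\in\mathbb R^d$, all weights $\omega_i\ge0$ and all $S\subset[n]$ with $\sum_{i\in[n]\setminus S}\omega_i\le b$, $$\Bigl\|F\bigl((\omega_i,z_i)_{i\in[n]}\bigr)-\sum_{i\in S}\omega_iz_i\Bigr\|^2\le\rho b\sum_{i\in S}\omega_i\|z_i\|^2.$$ $\mathrm{GTS}$: order the inputs so that $\|z_1\|\le\dots\le\|z_n\|$ (ties broken arbitrarily). Let $k^*=\max\{k\in[n]:\sum_{i\ge k}\omega_i\ge b\}$ and $\tilde\omega_{k^*}=\sum_{i\ge k^*}\omega_i-b$. Then $$\mathrm{GTS}\bigl((\omega_i,z_i)_{i\in[n]}\bigr)=\tilde\omega_{k^*}z_{k^*}+\sum_{i<k^*}\omega_iz_i .$$ Convention: if $\sum_{i\in[n]}\omega_i<b$ (so $k^*$ does not exist), the output is $0$. $\mathrm{CS}_+$: for $z\in\mathbb R^d$ and $\tau\ge0$, $\mathrm{Clip}(z;\tau)=\frac{z}{\|z\|}\min(\|z\|,\tau)$, with $\mathrm{Clip}(0;\tau)=0$.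 Then $$\mathrm{CS}_+\bigl((\omega_i,z_i)_{i\in[n]}\bigr)=\sum_{i=1}^n\omega_i\,\mathrm{Clip}(z_i;\tau_+),\qquad \tau_+=\max\Bigl\{\tau\ge0:\ \sum_{i=1}^n\omega_i\mathbf 1_{\|z_i\|\ge\tau}\ge2b\Bigr\}.$$ Conventions: $\tau_+=0$ if this set is empty, and $\tau_+=+\infty$ (no clipping) if it is unbounded, i.e. if $b=0$. *)

(* Defs.v *)
From HB Require Import structures.
From mathcomp Require Import all_boot all_order all_algebra all_fingroup.
From mathcomp Require Import all_classical all_reals all_analysis.

Set Implicit Arguments.
Unset Strict Implicit.
Unset Printing Implicit Defensive.
Import Order.TTheory GRing.Theory Num.Theory.
Local Open Scope classical_set_scope.
Local Open Scope ring_scope.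

(* Euclidean norm; the canonical norm `|z| on 'rV[R]_d is the sup norm. *)
Definition enorm (R : realType) (d : nat) (z : 'rV[R]_d) : R :=
  Num.sqrt (\sum_(j < d) z ord0 j ^+ 2).

(* Weights are typed in R; their nonnegativity is a hypothesis of
   [robust_summation]. *)
Definition aggregation_rule (R : realType) (n d : nat) : Type :=
  ('I_n -> R) -> ('I_n -> 'rV[R]_d) -> 'rV[R]_d.

Definition robust_summation (R : realType) (n d : nat) (b rho : R)
    (F : aggregation_rule R n d) : Prop :=
  forall (w : 'I_n -> R) (z : 'I_n -> 'rV[R]_d) (S : {set 'I_n}),
    (forall i, 0 <= w i) ->
    \sum_(i in ~: S) w i <= b ->
    enorm (F w z - \sum_(i in S) w i *: z i) ^+ 2
      <= rho * b * \sum_(i in S) w i * enorm (z i) ^+ 2.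

(* A tie-breaking choice: for every input, a permutation [s] such that
   z (s 0), z (s 1), ... have nondecreasing norms. "Ties broken arbitrarily"
   is rendered by quantifying over all such choices. *)
Definition norm_ordering (R : realType) (n d : nat)
    (s : ('I_n -> R) -> ('I_n -> 'rV[R]_d) -> 'S_n) : Prop :=
  forall w z (i j : 'I_n), (i <= j)%N ->
    enorm (z (s w z i)) <= enorm (z (s w z j)).

Lemma norm_ordering_exists (R : realType) (n d : nat) :
  exists s : ('I_n -> R) -> ('I_n -> 'rV[R]_d) -> 'S_n, norm_ordering s.
Proof.
have H (z : 'I_n -> 'rV[R]_d) : exists s : 'S_n, forall i j : 'I_n,
    (i <= j)%N -> enorm (z (s i)) <= enorm (z (s j)).
  pose r := [rel i j : 'I_n | enorm (z i) <= enorm (z j)].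
  have rtot : total r by move=> i j; exact: le_total.
  have rtr : transitive r by move=> j i k; exact: le_trans.
  have rr : reflexive r by move=> i; exact: lexx.
  have : perm_eq (sort r (ord_tuple n)) (ord_tuple n) by rewrite perm_sort.
  case/tuple_permP => s es; exists s => i j ij.
  have nthE (k : 'I_n) : nth i (sort r (ord_tuple n)) k = s k.
    by rewrite es -tnth_nth tnth_mktuple tnth_ord_tuple.
  rewrite -!nthE; apply: (sorted_leq_nth rtr rr i (sort_sorted rtot _)) => //;
    by rewrite inE size_sort size_tuple.
by have [s sP] := choice H; exists (fun _ => s) => w z; exact: sP.
Qed.

Definition tail_weight (R : realType) (n : nat) (w : 'I_n -> R) (k : 'I_n) : R :=
  \sum_(i < n | (k <= i)%N) w i.

Definition kstar (R : realType) (n : nat) (b : R) (w : 'I_n -> R) :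
    option 'I_n :=
  [pick k : 'I_n | (b <= tail_weight w k)
     && [forall j : 'I_n, (b <= tail_weight w j) ==> (j <= k)%N]].

(* [kstar] is [None] exactly when no tail weight reaches [b]. *)
Definition GTS (R : realType) (n d : nat)
    (s : ('I_n -> R) -> ('I_n -> 'rV[R]_d) -> 'S_n) (b : R) :
    aggregation_rule R n d :=
  fun w z =>
    let w' i := w (s w z i) in
    let z' i := z (s w z i) in
    if kstar b w' is Some k then
      (tail_weight w' k - b) *: z' k + \sum_(i < n | (i < k)%N) w' i *: z' i
    else 0.

(* The threshold may be +oo, in which case [clip z +oo = z]; [clip 0 tau = 0]
   since scaling 0 gives 0. *)
Definition clip (R : realType) (d : nat) (z : 'rV[R]_d) (tau : \bar R) :
    'rV[R]_d :=
  fine (Order.min (enorm z)%:E tau) *: ((enorm z)^-1 *: z).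

Definition is_max (R : realType) (A : set R) (t : R) : Prop :=
  A t /\ ubound A t.

Definition thresholds (R : realType) (n d : nat) (b : R)
    (w : 'I_n -> R) (z : 'I_n -> 'rV[R]_d) : set R :=
  [set t : R | 0 <= t /\ 2 * b <= \sum_(i < n | t <= enorm (z i)) w i].

Definition tau_plus (R : realType) (n d : nat) (b : R)
    (w : 'I_n -> R) (z : 'I_n -> 'rV[R]_d) : \bar R :=
  let A := thresholds b w z in
  if `[< A = set0 >] then 0%E
  else if `[< has_ubound A >] then (xget 0 (is_max A))%:E
  else +oo%E.

Definition CS_plus (R : realType) (n d : nat) (b : R) :
    aggregation_rule R n d :=
  fun w z => \sum_(i < n) w i *: clip (z i) (tau_plus b w z).

(* Main.v *)
Require Import Defs.
From HB Require Import structures.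
From mathcomp Require Import all_boot all_order all_algebra all_fingroup.
From mathcomp Require Import all_classical all_reals all_analysis.
From mathcomp Require Import ring lra.
Import Order.TTheory GRing.Theory Num.Theory.
Local Open Scope ring_scope.

(** For each rule the error splits into what it keeps outside [S] and what it loses inside [S].
    Since weight at most [b] lies outside [S], the former can be charged to long vectors of [S], and
    weighted Jensen bounds the total by the second moment over [S]. For GTS ([trimmed_sum_error]),
    at least as much weight is removed inside [S] as is kept outside, and from vectors at least as
    long. The error is at most twice the removed part, whose weight is at most [b]; squaring the 2
    gives 4. For CS_+ ([clipped_sum_error]), the maximal threshold [t] is reached by weight at least
    [2b] and exceeded by weight at most [2b]. The outside part is at most [b t], and the clipping
    loss is the excess of norms over [t]. The sum of the two is a first moment of weight at most
    [2b] in [S], so Jensen gives 2. *)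

(** * Weighted Cauchy-Schwarz and Jensen inequalities *)

Lemma cauchy_schwarz_sum (R : realType) (I : finType) (P : pred I)
    (w x y : I -> R) (w0 : forall i, 0 <= w i) :
  (\sum_(i | P i) w i * (x i * y i)) ^+ 2 <=
    (\sum_(i | P i) w i * x i ^+ 2) * (\sum_(i | P i) w i * y i ^+ 2).
Proof.
set B := \sum_(i | P i) w i * (x i * y i).
set A := \sum_(i | P i) w i * x i ^+ 2.
set C := \sum_(i | P i) w i * y i ^+ 2.
have quad (c e : R) : 0 <= c ^+ 2 * A - 2 * c * e * B + e ^+ 2 * C.
  rewrite !mulr_sumr -sumrB -big_split /=; apply: sumr_ge0 => i _.
  have -> : c ^+ 2 * (w i * x i ^+ 2) - 2 * c * e * (w i * (x i * y i))
      + e ^+ 2 * (w i * y i ^+ 2) = w i * (c * x i - e * y i) ^+ 2 by ring.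
  by rewrite mulr_ge0 ?sqr_ge0.
have A0 : 0 <= A by apply: sumr_ge0 => i _; rewrite mulr_ge0 ?sqr_ge0.
(* At [c = B], [e = A] the quadratic form equals A (A C - B^2). *)
have [A_gt0|A_le0] := ltP 0 A; first by have := quad B A; nra.
have A_eq0 : A = 0 by apply/eqP; rewrite eq_le A_le0.
suff -> : B = 0 by rewrite A_eq0 expr0n mul0r.
apply: big1 => i Pi.
have /eqP := psumr_eq0P (fun j _ => mulr_ge0 (w0 j) (sqr_ge0 (x j))) A_eq0 Pi.
by rewrite mulf_eq0 sqrf_eq0 => /orP[] /eqP ->; rewrite ?mul0r ?mulr0.
Qed.

Lemma jensen_sqr_sum (R : realType) (I : finType) (P : pred I)
    (w x : I -> R) (w0 : forall i, 0 <= w i) :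
  (\sum_(i | P i) w i * x i) ^+ 2 <=
    (\sum_(i | P i) w i) * (\sum_(i | P i) w i * x i ^+ 2).
Proof.
have := cauchy_schwarz_sum R I P w (fun=> 1) x w0.
under eq_bigr do rewrite mul1r.
by under [X in _ <= X * _]eq_bigr do rewrite expr1n mulr1.
Qed.

(** * The Euclidean norm *)

Section EuclideanNorm.
Context {R : realType} {d : nat}.
Implicit Types (x y z : 'rV[R]_d) (c : R).

Lemma enorm_ge0 z : 0 <= enorm z.
Proof. exact: sqrtr_ge0. Qed.

Lemma sqr_enorm z : enorm z ^+ 2 = \sum_j z ord0 j ^+ 2.
Proof. by rewrite sqr_sqrtr // sumr_ge0 // => j _; exact: sqr_ge0. Qed.

Lemma enorm0 : enorm (0 : 'rV[R]_d) = 0.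
Proof. by rewrite /enorm big1 ?sqrtr0 // => j _; rewrite mxE expr0n. Qed.

Lemma enorm_eq0 z : enorm z = 0 -> z = 0.
Proof.
move=> z0; have := sqr_enorm z; rewrite z0 expr0n => /esym s0.
apply/rowP => j; rewrite mxE; apply/eqP; rewrite -sqrf_eq0; apply/eqP.
exact: (psumr_eq0P (fun j _ => sqr_ge0 (z ord0 j)) s0 (i := j) isT).
Qed.

Lemma enormZ c z : enorm (c *: z) = `|c| * enorm z.
Proof.
rewrite /enorm -sqrtr_sqr -sqrtrM ?sqr_ge0 // mulr_sumr.
by congr Num.sqrt; apply: eq_bigr => j _; rewrite mxE exprMn.
Qed.

Lemma ler_enormD x y : enorm (x + y) <= enorm x + enorm y.
Proof.
have xy0 : 0 <= enorm x + enorm y by rewrite addr_ge0 ?enorm_ge0.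
rewrite -(ler_pXn2r (n := 2)) ?nnegrE ?enorm_ge0 //.
have -> : enorm (x + y) ^+ 2 = enorm x ^+ 2 + enorm y ^+ 2
    + 2 * \sum_j 1 * (x ord0 j * y ord0 j).
  rewrite !sqr_enorm mulr_sumr -!big_split /=.
  by apply: eq_bigr => j _; rewrite mxE; ring.
have := cauchy_schwarz_sum R _ predT (fun=> 1) (x ord0) (y ord0) (fun=> ler01).
under [X in _ <= X * _]eq_bigr do rewrite mul1r.
under [X in _ <= _ * X]eq_bigr do rewrite mul1r.
rewrite -!sqr_enorm -exprMn.
have xy : 0 <= enorm x * enorm y by rewrite mulr_ge0 ?enorm_ge0.
set s := \sum_j _ => le2.
have : s <= enorm x * enorm y.
  rewrite (le_trans (ler_norm s)) //.
  by rewrite -(ler_pXn2r (n := 2)) ?nnegrE ?normr_ge0 // real_normK ?num_real.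
by nra.
Qed.

Lemma ler_enorm_sum (I : finType) (P : pred I) (v : I -> 'rV[R]_d) :
  enorm (\sum_(i | P i) v i) <= \sum_(i | P i) enorm (v i).
Proof.
apply: (big_ind2 (fun (u : 'rV[R]_d) (r : R) => enorm u <= r)) => //.
  by rewrite enorm0.
by move=> u1 r1 u2 r2 h1 h2; rewrite (le_trans (ler_enormD _ _)) // lerD.
Qed.

(** Triangle inequality, then Jensen. This settles the cases where a rule outputs 0, the error then
    being the sum over [S] itself. *)
Lemma sqr_enorm_sum_le (I : finType) (P : pred I) (w : I -> R)
    (v : I -> 'rV[R]_d) (w0 : forall i, 0 <= w i) :
  enorm (\sum_(i | P i) w i *: v i) ^+ 2 <=
    (\sum_(i | P i) w i) * \sum_(i | P i) w i * enorm (v i) ^+ 2.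
Proof.
apply: le_trans (jensen_sqr_sum R _ _ _ _ w0).
rewrite ler_pXn2r ?nnegrE ?enorm_ge0 //; last first.
  by apply: sumr_ge0 => i _; rewrite mulr_ge0 ?enorm_ge0.
apply: (le_trans (ler_enorm_sum _ _ _)); apply: ler_sum => i _.
by rewrite enormZ ger0_norm.
Qed.

End EuclideanNorm.

(** * The geometric trimmed sum *)

Lemma sum_setC (V : zmodType) (I : finType) (S : {set I}) (f : I -> V) :
  \sum_i f i = \sum_(i in S) f i + \sum_(i in ~: S) f i.
Proof.
rewrite (bigID (mem S)) /=; congr (_ + _).
by apply: eq_bigl => i; rewrite inE.
Qed.

(* Trimming removes weight [b] in total; the weight it retains outside [S] is
   at most the weight [T] it removes inside [S], and each retained vector is no
   longer than each removed one, so the error is at most twice the removed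
   part of the sum over [S]. *)
Lemma trimmed_sum_error (R : realType) (n d : nat) (b t : R)
    (w a : 'I_n -> R) (z : 'I_n -> 'rV[R]_d) (S : {set 'I_n}) :
  (forall i, 0 <= a i <= w i) -> \sum_i (w i - a i) = b ->
  (forall i, a i != 0 -> enorm (z i) <= t) ->
  (forall i, a i != w i -> t <= enorm (z i)) ->
  \sum_(i in ~: S) w i <= b ->
  enorm (\sum_i a i *: z i - \sum_(i in S) w i *: z i) ^+ 2
    <= 4 * b * \sum_(i in S) w i * enorm (z i) ^+ 2.
Proof.
move=> aw sumb at_ wt_ wb.
have a0 i : 0 <= a i by case/andP: (aw i).
have wa0 i : 0 <= w i - a i by rewrite subr_ge0; case/andP: (aw i).
pose T := \sum_(i in S) (w i - a i).
pose X := \sum_(i in S) (w i - a i) * enorm (z i).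
pose Y := \sum_(i in S) (w i - a i) * enorm (z i) ^+ 2.
have T0 : 0 <= T by exact: sumr_ge0.
have Y0 : 0 <= Y by apply: sumr_ge0 => i _; rewrite mulr_ge0 ?sqr_ge0.
have X0 : 0 <= X by apply: sumr_ge0 => i _; rewrite mulr_ge0 ?enorm_ge0.
have XTY : X ^+ 2 <= T * Y by exact: jensen_sqr_sum.
have Tb : T <= b.
  by rewrite -sumb (sum_setC _ _ S) lerDl; exact: sumr_ge0.
(* Weight [b - T] is removed outside [S], where there is at most [b]. *)
have retained : \sum_(i in ~: S) a i <= T.
  by move: sumb; rewrite (sum_setC _ _ S) -/T sumrB; lra.
have tX : T * t <= X.
  rewrite mulr_suml; apply: ler_sum => i _.
  have [->|/wt_ h] := eqVneq (a i) (w i); first by rewrite subrr !mul0r.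
  exact: ler_wpM2l.
have err : enorm (\sum_i a i *: z i - \sum_(i in S) w i *: z i) <= 2 * X.
  have -> : \sum_i a i *: z i - \sum_(i in S) w i *: z i =
      \sum_(i in ~: S) a i *: z i + \sum_(i in S) (a i - w i) *: z i.
    rewrite (sum_setC _ _ S) addrAC -sumrB addrC; congr (_ + _).
    by apply: eq_bigr => i _; rewrite scalerBl.
  apply: (le_trans (ler_enormD _ _)).
  have -> : 2 * X = X + X by ring.
  apply: lerD; apply: (le_trans (ler_enorm_sum _ _ _)); last first.
    by apply: ler_sum => i _; rewrite enormZ distrC ger0_norm.
  have le_t : \sum_(i in ~: S) enorm (a i *: z i) <= (\sum_(i in ~: S) a i) * t.
    rewrite mulr_suml; apply: ler_sum => i _; rewrite enormZ ger0_norm //.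
    have [->|/at_ h] := eqVneq (a i) 0; first by rewrite !mul0r.
    exact: ler_wpM2l.
  (* A negative [t] bounds no norm from above, so then every [a i] is 0. *)
  have [t0|t_lt0] := leP 0 t.
    by apply: (le_trans le_t); apply: le_trans tX; exact: ler_wpM2r.
  rewrite big1 // => i _; rewrite enormZ.
  have [->|/at_ h] := eqVneq (a i) 0; first by rewrite normr0 mul0r.
  by have := enorm_ge0 (z i); lra.
have YS : Y <= \sum_(i in S) w i * enorm (z i) ^+ 2.
  by apply: ler_sum => i _; rewrite ler_wpM2r ?sqr_ge0 // lerBlDr lerDl.
have := enorm_ge0 (\sum_i a i *: z i - \sum_(i in S) w i *: z i).
set e := enorm _ in err *; set Z := \sum_(i in S) _ in YS * => e0.
(* The chain is e^2 <= 4 X^2 <= 4 T Y <= 4 b Z. *)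
have : T * Y <= b * Z by exact: ler_pM.
by nra.
Qed.

(** By maximality of [k] the tail from [k + 1] falls short of [b]; if [k] is the last index, that
    tail is empty. Hence the weight GTS keeps at [k] does not exceed [w k]. *)
Lemma tail_weight_gt_kstar (R : realType) (n : nat) (b : R) (w : 'I_n -> R)
    (k : 'I_n) :
  0 <= b -> (forall j : 'I_n, b <= tail_weight w j -> (j <= k)%N) ->
  \sum_(i < n | (k < i)%N) w i <= b.
Proof.
move=> b0 kmax; have [kn|nk] := ltnP k.+1 n; last first.
  rewrite big_pred0 // => i; apply/negbTE; rewrite -leqNgt.
  by rewrite -ltnS (leq_trans (ltn_ord i)).
have := kmax (Ordinal kn); rewrite /= ltnn /tail_weight /= => h.
by rewrite leNgt; apply/negP => /ltW /h.
Qed.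

Lemma robust_summation_GTS (R : realType) (n d : nat) (b : R)
    (s : ('I_n -> R) -> ('I_n -> 'rV[R]_d) -> 'S_n) :
  0 <= b -> norm_ordering s -> robust_summation b 4 (GTS s b).
Proof.
move=> b0 sP w z S w0 wb; rewrite /GTS.
set p := s w z; set w' := fun i => w (p i); set z' := fun i => z (p i).
(* Pulling [S] back along the sorting permutation lets the argument run on the sorted inputs. *)
pose S' := [set i | p i \in S].
have reS (V : zmodType) (f : 'I_n -> V) :
    \sum_(i in S) f i = \sum_(i in S') f (p i).
  rewrite (reindex_inj (@perm_inj _ p)) /=.
  by apply: eq_bigl => i; rewrite inE.
have reSC : \sum_(i in ~: S) w i = \sum_(i in ~: S') w' i.
  rewrite (reindex_inj (@perm_inj _ p)) /=.
  by apply: eq_bigl => i; rewrite !inE.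
have w'0 i : 0 <= w' i by exact: w0.
rewrite reSC in wb.
have -> : \sum_(i in S) w i *: z i = \sum_(i in S') w' i *: z' i.
  exact: (reS _ (fun i => w i *: z i)).
have -> : \sum_(i in S) w i * enorm (z i) ^+ 2 =
    \sum_(i in S') w' i * enorm (z' i) ^+ 2.
  exact: (reS _ (fun i => w i * enorm (z i) ^+ 2)).
rewrite /kstar; case: pickP => [k /andP[bk /forallP kmax]|none].
- have {}kmax j : b <= tail_weight w' j -> (j <= k)%N by exact/implyP.
  have tailE : tail_weight w' k = w' k + \sum_(i < n | (k < i)%N) w' i.
    rewrite /tail_weight (bigD1 k) //=; congr (_ + _).
    by apply: eq_bigl => i; rewrite ltn_neqAle andbC eq_sym.
  have gtb := tail_weight_gt_kstar _ _ _ _ _ b0 kmax.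
  (* The weights GTS retains: all below [k], a part at [k], none above; what is removed sums to
     [b]. *)
  pose a (i : 'I_n) := if (i < k)%N then w' i
    else if i == k then tail_weight w' k - b else 0.
  have -> : (tail_weight w' k - b) *: z' k
      + \sum_(i < n | (i < k)%N) w' i *: z' i = \sum_i a i *: z' i.
    rewrite [RHS](bigD1 k) //= {1}/a ltnn eqxx; congr (_ + _).
    rewrite big_mkcond [RHS]big_mkcond; apply: eq_bigr => i _.
    by rewrite /a -!val_eqE /=; case: ltngtP; rewrite ?scale0r.
  apply: (@trimmed_sum_error _ _ _ _ (enorm (z' k))) => //.
  + move=> i; rewrite /a; case: ifP => _; first by rewrite w'0 lexx.
    case: eqP => [->|_]; last by rewrite lexx w'0.
    by rewrite subr_ge0 bk tailE; lra.
  + rewrite (bigD1 k) //= {1}/a ltnn eqxx.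
    rewrite (_ : \sum_(i | i != k) _ = \sum_(i < n | (k < i)%N) w' i).
      by rewrite tailE; ring.
    rewrite big_mkcond [RHS]big_mkcond; apply: eq_bigr => i _.
    by rewrite /a -!val_eqE /=; case: ltngtP; rewrite ?subrr ?subr0.
  + move=> i; rewrite /a => ai; apply: sP; apply: contraNT ai; rewrite -ltnNge.
    by rewrite -val_eqE /=; case: ltngtP.
  + move=> i; rewrite /a => ai; apply: sP; apply: contraNT ai; rewrite -ltnNge.
    by move=> ->.
(* If the total weight exceeded [b], some tail would reach [b], and the largest such index would
   have been picked. *)
- have totb : \sum_i w' i <= b.
    case: n => [|n] in s sP w z S w0 p w' z' S' reS reSC w'0 wb none *.
      by rewrite big_ord0.
    have tail0 : tail_weight w' ord0 = \sum_i w' i by exact: eq_bigl.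
    rewrite leNgt; apply/negP => blt.
    case: (@arg_maxnP _ ord0 (fun j => b <= tail_weight w' j) val) => /=.
      by rewrite tail0 ltW.
    move=> k bk kmax; have /negP := negbT (none k); apply.
    by rewrite bk; apply/forallP => j; apply/implyP => /kmax.
  rewrite sub0r -scaleN1r enormZ normrN1 mul1r.
  apply: (le_trans (sqr_enorm_sum_le _ _ _ _ w'0)).
  have : 0 <= \sum_(i in S') w' i * enorm (z' i) ^+ 2.
    by apply: sumr_ge0 => i _; rewrite mulr_ge0 ?sqr_ge0.
  have : \sum_(i in S') w' i <= b.
    by rewrite (le_trans _ totb) // (sum_setC _ _ S') lerDl sumr_ge0.
  by nra.
Qed.

(** * Clipping and the clipped sum *)

Section Clip.
Context {R : realType} {d : nat}.
Implicit Types (z : 'rV[R]_d) (t : R).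

Lemma clip_fin z t :
  clip z t%:E = (Num.min (enorm z) t / enorm z) *: z.
Proof. by rewrite /clip -EFin_min /= scalerA. Qed.

Lemma clip0 z : clip z 0%E = 0.
Proof. by rewrite clip_fin min_r ?enorm_ge0 // mul0r scale0r. Qed.

Lemma clip_le z t : enorm z <= t -> clip z t%:E = z.
Proof.
move=> zt; rewrite clip_fin min_l //.
(* For a zero vector the scaling factor is 0 / 0 = 0 rather than 1, but both sides vanish. *)
have [/enorm_eq0 ->|z0] := eqVneq (enorm z) 0.
  by rewrite scaler0.
by rewrite divff ?scale1r.
Qed.

Lemma clipy z : clip z +oo%E = z.
Proof. by rewrite -[RHS](clip_le z (enorm z)) // /clip miney minxx. Qed.

Lemma enorm_clip_le z t : 0 <= t -> enorm (clip z t%:E) <= t.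
Proof.
move=> t0; have [zt|tz] := leP (enorm z) t; first by rewrite clip_le.
have z0 : 0 < enorm z by exact: le_lt_trans tz.
rewrite clip_fin (min_r (ltW tz)) enormZ ger0_norm; last first.
  by rewrite divr_ge0 ?enorm_ge0.
by rewrite (divfK (lt0r_neq0 z0)).
Qed.

Lemma enorm_sub_clip z t : 0 <= t < enorm z ->
  enorm (z - clip z t%:E) = enorm z - t.
Proof.
case/andP=> t0 tz; have z0 : 0 < enorm z by exact: le_lt_trans tz.
rewrite clip_fin (min_r (ltW tz)) -{1}[z]scale1r -scalerBl enormZ.
rewrite ger0_norm ?subr_ge0 ?ler_pdivrMr ?mul1r ?ltW //.
by rewrite mulrBl mul1r (divfK (lt0r_neq0 z0)).
Qed.

End Clip.

(* Clipping at a level [t] which weight at least [2b] reaches and weight at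
   most [2b] exceeds. Let [P] be the weight exceeding [t] within [S]; weight at
   least [b] reaches [t] within [S]. If [P < b], the bias [b * t] of the
   vectors outside [S] is charged to weight [b - P] of vectors of [S] of norm
   exactly [t]. *)
Lemma clipped_sum_error (R : realType) (n d : nat) (b t : R)
    (w : 'I_n -> R) (z : 'I_n -> 'rV[R]_d) (S : {set 'I_n}) :
  0 <= b -> 0 <= t -> (forall i, 0 <= w i) ->
  \sum_(i in ~: S) w i <= b ->
  2 * b <= \sum_(i < n | t <= enorm (z i)) w i ->
  \sum_(i < n | t < enorm (z i)) w i <= 2 * b ->
  enorm (\sum_i w i *: clip (z i) t%:E - \sum_(i in S) w i *: z i) ^+ 2
    <= 2 * b * \sum_(i in S) w i * enorm (z i) ^+ 2.
Proof.
move=> b0 t0 w0 wb reach exceed.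
pose P := \sum_(i in S | t < enorm (z i)) w i.
pose Q := \sum_(i in S | enorm (z i) == t) w i.
pose X := \sum_(i in S | t < enorm (z i)) w i * enorm (z i).
pose Y := \sum_(i in S | t < enorm (z i)) w i * enorm (z i) ^+ 2.
have P0 : 0 <= P by exact: sumr_ge0.
have Q0 : 0 <= Q by exact: sumr_ge0.
have X0 : 0 <= X by apply: sumr_ge0 => i _; rewrite mulr_ge0 ?enorm_ge0.
have Y0 : 0 <= Y by apply: sumr_ge0 => i _; rewrite mulr_ge0 ?sqr_ge0.
have XPY : X ^+ 2 <= P * Y by exact: jensen_sqr_sum.
have P2b : P <= 2 * b.
  apply: le_trans exceed; rewrite [P]big_mkcond [leRHS]big_mkcond /=.
  by apply: ler_sum => i _; case: (i \in S); case: ifP.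
have bPQ : b <= P + Q.
  have : \sum_(i < n | t <= enorm (z i)) w i <= \sum_(i in ~: S) w i + (P + Q).
    rewrite big_mkcond [X in X + _]big_mkcond [P]big_mkcond [Q]big_mkcond /=.
    rewrite -!big_split /=.
    apply: ler_sum => i _; rewrite inE; have := w0 i.
    by case: (i \in S); case: ltgtP => //= _ wi0; lra.
  by lra.
have ZYQ : Y + Q * t ^+ 2 <= \sum_(i in S) w i * enorm (z i) ^+ 2.
  rewrite mulr_suml [Y]big_mkcond [X in _ + X]big_mkcond [leRHS]big_mkcond /=.
  rewrite -big_split /=.
  apply: ler_sum => i _; have := mulr_ge0 (w0 i) (sqr_ge0 (enorm (z i))).
  by case: (i \in S); case: ltgtP => //= [_|_|->] wi0; lra.
have err : enorm (\sum_i w i *: clip (z i) t%:E - \sum_(i in S) w i *: z i)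
    <= b * t + (X - P * t).
  have -> : \sum_i w i *: clip (z i) t%:E - \sum_(i in S) w i *: z i =
      \sum_(i in ~: S) w i *: clip (z i) t%:E
      + \sum_(i in S) (- w i) *: (z i - clip (z i) t%:E).
    rewrite (sum_setC _ _ S) addrAC -sumrB addrC; congr (_ + _).
    by apply: eq_bigr => i _; rewrite scaleNr scalerBr opprB.
  apply: (le_trans (ler_enormD _ _)); apply: lerD.
    apply: (le_trans (ler_enorm_sum _ _ _)).
    apply: (@le_trans _ _ ((\sum_(i in ~: S) w i) * t)); last exact: ler_wpM2r.
    rewrite mulr_suml; apply: ler_sum => i _.
    by rewrite enormZ ger0_norm // ler_wpM2l // enorm_clip_le.
  apply: (le_trans (ler_enorm_sum _ _ _)).
  rewrite /X /P mulr_suml -sumrB big_mkcondr /=; apply: ler_sum => i _.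
  rewrite enormZ normrN ger0_norm //; case: ltP => tz.
    by rewrite enorm_sub_clip ?t0 // mulrBr.
  by rewrite clip_le // subrr enorm0 mulr0.
have := enorm_ge0 (\sum_i w i *: clip (z i) t%:E - \sum_(i in S) w i *: z i).
move: err ZYQ; set e := enorm _; set Z := \sum_(i in S) _ => err ZYQ e0.
have [Pb|bP] := ltP P b; last first.
  (* As [b * t <= P * t], the bias is absorbed by the subtracted [P * t]. The constant 2 comes from
     [P <= 2 * b]. *)
  have eX : e <= X by nra.
  have Qt0 : 0 <= Q * t ^+ 2 by rewrite mulr_ge0 ?sqr_ge0.
  have : P * Y <= 2 * b * Z by apply: ler_pM => //; lra.
  have : e ^+ 2 <= X ^+ 2 by rewrite ler_pXn2r ?nnegrE.
  by lra.
pose E := (b - P) * t + X.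
have E0 : 0 <= E by rewrite addr_ge0 // mulr_ge0 // subr_ge0 ltW.
have YZ : Y + (b - P) * t ^+ 2 <= Z.
  apply: le_trans ZYQ; rewrite lerD2l ler_wpM2r ?sqr_ge0 //; lra.
(* Jensen's inequality for weight [P] spread over norms exceeding [t] and an
   extra weight [b - P] placed at [t]. *)
have EbZ : E ^+ 2 <= b * (Y + (b - P) * t ^+ 2).
  have [P_gt0|P_le0] := ltP 0 P.
    have h : 0 <= (P * t - X) ^+ 2 by exact: sqr_ge0.
    have h1 : 0 <= (b - P) * (P * t - X) ^+ 2 by rewrite mulr_ge0 //; lra.
    have h2 : 0 <= b * (P * Y - X ^+ 2) by rewrite mulr_ge0 //; lra.
    rewrite -(ler_pM2l P_gt0) -subr_ge0.
    suff -> : P * (b * (Y + (b - P) * t ^+ 2)) - P * E ^+ 2 =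
      (b - P) * (P * t - X) ^+ 2 + b * (P * Y - X ^+ 2) by rewrite addr_ge0.
    by rewrite /E; ring.
  (* With no weight above [t], [X] vanishes too and [E] is just [b * t]. *)
  have P_eq0 : P = 0 by apply/eqP; rewrite eq_le P_le0.
  have X_eq0 : X = 0.
    by apply/eqP; rewrite -sqrf_eq0 eq_le sqr_ge0 andbT; rewrite P_eq0 mul0r in XPY.
  by rewrite /E X_eq0 P_eq0; nra.
have : e ^+ 2 <= E ^+ 2 by rewrite ler_pXn2r ?nnegrE // /E; lra.
have bY : b * (Y + (b - P) * t ^+ 2) <= b * Z by exact: ler_wpM2l.
have Z0 : 0 <= Z by apply: sumr_ge0 => i _; rewrite mulr_ge0 ?sqr_ge0.
have := mulr_ge0 b0 Z0.
by lra.
Qed.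

(** Raising a threshold to the smallest norm that reaches it keeps the same vectors, so it suffices
    to maximize over the finitely many norms. Positivity of [b] ensures that some vector reaches
    each threshold. *)
Lemma thresholds_max (R : realType) (n d : nat) (b : R)
    (w : 'I_n -> R) (z : 'I_n -> 'rV[R]_d) :
  0 < b -> (thresholds b w z !=set0)%classic ->
  exists t, is_max (thresholds b w z) t.
Proof.
move=> b0.
pose A (i : 'I_n) := 2 * b <= \sum_(j < n | enorm (z i) <= enorm (z j)) w j.
have dom t : thresholds b w z t -> exists2 i, A i & t <= enorm (z i).
  case=> t0 tb.
  have [/existsP[i0 ti0]|] := boolP [exists i, t <= enorm (z i)]; last first.
    rewrite negb_exists => /forallP tz; move: tb.
    rewrite big_pred0 ?leNgt ?mulr_gt0 // => i.
    exact/negbTE/tz.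
  case: (@arg_minP _ _ _ i0 (fun i => t <= enorm (z i)) (fun i => enorm (z i)))
    => // i ti imin.
  exists i => //; rewrite /A (eq_bigl (fun j => t <= enorm (z j))) // => j.
  by apply/idP/idP => [|/imin //]; exact: le_trans.
case=> t /dom[i0 Ai0 _].
case: (@arg_maxP _ _ _ i0 A (fun i => enorm (z i))) => // i Ai imax.
exists (enorm (z i)); split; first by split; first exact: enorm_ge0.
by move=> u /dom[j Aj uj]; exact: le_trans (imax j Aj).
Qed.

(** The vectors exceeding [t] are exactly those reaching the smallest norm above [t]; with weight
    over [2 * b] they would make that norm a larger threshold. *)
Lemma weight_gt_max_threshold (R : realType) (n d : nat) (b t : R)
    (w : 'I_n -> R) (z : 'I_n -> 'rV[R]_d) :
  0 <= b -> is_max (thresholds b w z) t ->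
  \sum_(i < n | t < enorm (z i)) w i <= 2 * b.
Proof.
move=> b0 [_ tmax].
have [/existsP[i0 ti0]|] := boolP [exists i, t < enorm (z i)]; last first.
  rewrite negb_exists => /forallP tz; rewrite big_pred0 ?mulr_ge0 // => i.
  exact/negbTE/tz.
case: (@arg_minP _ _ _ i0 (fun i => t < enorm (z i)) (fun i => enorm (z i)))
  => // i ti imin.
rewrite leNgt; apply/negP => /ltW lt2b; move: (ti); rewrite ltNge => /negP; apply.
apply: tmax; split; first exact: enorm_ge0.
rewrite (eq_bigl (fun j => t < enorm (z j))) // => j.
by apply/idP/idP => [|/imin //]; exact: lt_le_trans.
Qed.

Lemma robust_summation_CS_plus (R : realType) (n d : nat) (b : R) :
  0 <= b -> robust_summation b 2 (@CS_plus R n d b).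
Proof.
move=> b0 w z S w0 wb; rewrite /CS_plus /tau_plus.
have Z0 : 0 <= \sum_(i in S) w i * enorm (z i) ^+ 2.
  by apply: sumr_ge0 => i _; rewrite mulr_ge0 ?sqr_ge0.
case: asboolP => [A0|/eqP/set0P An0].
  rewrite big1 => [|i _]; last by rewrite clip0 scaler0.
  rewrite sub0r -scaleN1r enormZ normrN1 mul1r.
  apply: (le_trans (sqr_enorm_sum_le _ _ _ _ w0)); apply: ler_wpM2r => //.
  (* Every vector reaches level 0, so an empty threshold set means total weight below [2 * b]. *)
  rewrite leNgt; apply/negP => lt2b; suff : thresholds b w z 0 by rewrite A0.
  split=> //; rewrite (eq_bigl predT) => [|i]; last by rewrite enorm_ge0.
  by rewrite (sum_setC _ _ S) (le_trans (ltW lt2b)) // lerDl sumr_ge0.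
have [b_gt0|b_le0] := ltP 0 b.
  have [t tmax] := thresholds_max _ _ _ _ _ _ b_gt0 An0.
  case: asboolP => [_|[]]; last by exists t; case: tmax.
  have := xgetI 0 tmax; set u := xget _ _ => umax.
  have [[u0 ub] _] := umax.
  by apply: clipped_sum_error => //; exact: weight_gt_max_threshold.
have b_eq0 : b = 0 by apply/eqP; rewrite eq_le b_le0.
case: asboolP => [[M Mub]|_].
  (* For [b = 0] every nonnegative level is a threshold, so no upper bound [M] exists. *)
  suff : `|M| + 1 <= M by have := ler_norm M; lra.
  apply: Mub; split; first by rewrite addr_ge0.
  by rewrite b_eq0 mulr0 sumr_ge0.
(* With [b = 0] the weights outside [S] vanish, and the unclipped sum is exact. *)
have wS0 i : i \in ~: S -> w i = 0.
  apply: psumr_eq0P => //; apply/eqP; rewrite eq_le sumr_ge0 // andbT.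
  exact: le_trans wb b_le0.
have -> : \sum_i w i *: clip (z i) +oo = \sum_i w i *: z i.
  by apply: eq_bigr => i _; rewrite clipy.
rewrite (sum_setC _ _ S) addrAC subrr add0r big1 => [|i /wS0 ->].
  by rewrite enorm0 expr0n /= !mulr_ge0.
by rewrite scale0r.
Qed.

Theorem theorem4p1 (R : realType) (n d : nat) (b : R) (hb : 0 <= b) :
  (forall s : ('I_n -> R) -> ('I_n -> 'rV[R]_d) -> 'S_n,
     norm_ordering s -> robust_summation b 4 (GTS s b)) /\
  robust_summation b 2 (@CS_plus R n d b).
Proof.
split; last exact: robust_summation_CS_plus.
by move=> s; exact: robust_summation_GTS.
Qed.
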